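(* Let $\Gamma=\mathrm{IOCG}_n(\mathbf{D},\sigma)$ be an integral oriented circulant graph. Then the following two statements are equivalent: (i) $\Gamma$ has multiple state transfer between vertices $b$, $b+n/4$, $b+n/2$, $b+3n/4$, for all $b\in\mathbb{Z}_n$; (ii) $n\in 8\mathbb{N}$, $\mathbf{D}_2=\{n/4\}$, and $\mathbf{D}_3=\{n/8\}$.
   Context: Let $n$ be a positive integer with $n\equiv 0\pmod 4$. For a positive divisor $d$ of $n/4$ and $r\in\{1,3\}$ let $G_n^r(d)=\{dk : k\equiv r \pmod 4,\ \gcd(dk,n)=d\}$, regarded as a subset of $\mathbb{Z}_n$. Given a nonempty set $\mathbf{D}$ of positive divisors of $n/4$ and a map $\sigma:\mathbf{D}\to\{1,-1\}$, put $S_n(d)=G_n^1(d)$ if $\sigma(d)=1$, $S_n(d)=G_n^3(d)$ if $\sigma(d)=-1$, and $\mathcal{C}=\bigcup_{d\in\mathbf{D}}S_n(d)$. Then $\mathrm{IOCG}_n(\mathbf{D},\sigma)$ is the oriented graph with vertex set $\mathbb{Z}_n$ and arc set $\{(a,b): b-a\in\mathcal{C}\}$; the (nonempty) integral oriented circulant graphs, i.e. those whose Hermitian adjacency matrix has only integer eigenvalues, are exactly these graphs. The Hermitian adjacency matrix $H=(h_{uv})$ of an oriented graph has $h_{uv}=\mathrm{i}$ if $(u,v)$ is an arc, $h_{uv}=-\mathrm{i}$ if $(v,u)$ is an arc, and $h_{uv}=0$ otherwise, where $\mathrm{i}=\sqrt{-1}$. Let $U(t)=\exp(\mathrm{i}tH)$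 and let $\mathbf{e}_u$ be the standard basis vector indexed by the vertex $u$. The graph has perfect state transfer from $u$ to $v$ if there are $t\in\mathbb{R}$ and a complex number $\gamma$ with $|\gamma|=1$ such that $U(t)\mathbf{e}_u=\gamma\mathbf{e}_v$; since $t$ may be any real number this relation is symmetric in $u,v$, and one says perfect state transfer between $u$ and $v$. The graph has multiple state transfer between the vertices of a set $S$ if perfect state transfer occurs between each pair of vertices in $S$ (the time may depend on the pair). For a positive integer $x$, $\vartheta_2(x)$ is the exponent of the largest power of $2$ dividing $x$. For $0\le i\le\vartheta_2(n)$, $\mathbf{D}_i=\{d\in\mathbf{D}:\vartheta_2(n/d)=i\}$. *)

(* Defs.v *)
From mathcomp Require Import all_boot all_order all_algebra finmap.
From mathcomp Require Import all_classical all_reals all_analysis.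
From mathcomp Require Import complex.

Set Implicit Arguments.
Unset Strict Implicit.
Unset Printing Implicit Defensive.

Import Order.TTheory GRing.Theory Num.Theory.
Import numFieldNormedType.Exports.

Local Open Scope ring_scope.
Local Open Scope complex_scope.

(* The limit is taken in the normed space of square matrices, where this
   series always converges. *)
Definition expmx (R : realType) (m : nat) (A : 'M[R[i]]_m) : 'M[R[i]]_m :=
  limn (series (fun k => (k`!%:R)^-1 *: A ^+ k)).

Definition hermitian_adj (R : realType) (m : nat) (arc : rel 'I_m) :
    'M[R[i]]_m :=
  \matrix_(u, v) (if arc u v then 'i else if arc v u then - 'i else 0).

Definition transition_mx (R : realType) (m : nat) (arc : rel 'I_m) (t : R) :
    'M[R[i]]_m :=
  expmx (('i * t%:C) *: hermitian_adj R arc).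

Definition perfect_state_transfer (R : realType) (m : nat) (arc : rel 'I_m)
    (u v : 'I_m) : Prop :=
  exists (t : R) (gamma : R[i]), `|gamma| = 1 /\
    transition_mx arc t *m (delta_mx u 0 : 'cV[R[i]]_m)
      = gamma *: (delta_mx v 0 : 'cV[R[i]]_m).

Definition multiple_state_transfer (R : realType) (m : nat) (arc : rel 'I_m)
    (S : {set 'I_m}) : Prop :=
  forall u v : 'I_m, u \in S -> v \in S -> u != v ->
    perfect_state_transfer R arc u v.

(* When 4 %| n, both conditions on k, and d * k in 'Z_n, depend only on k
   modulo n, so k may range over 'I_n instead of all the integers. *)
Definition G_set (n r d : nat) : {set 'Z_n} :=
  [set (d * k)%N%:R
    | k : 'I_n & (k == r %[mod 4])%N && (gcdn (d * k) n == d)%N].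

Definition S_set (n : nat) (sigma : nat -> int) (d : nat) : {set 'Z_n} :=
  if sigma d == 1 then G_set n 1 d else G_set n 3 d.

Definition connection_set (n : nat) (D : {fset nat}) (sigma : nat -> int) :
    {set 'Z_n} :=
  (\bigcup_(d <- D) S_set n sigma d)%SET.

Definition IOCG (n : nat) (D : {fset nat}) (sigma : nat -> int) : rel 'Z_n :=
  fun a b => b - a \in connection_set n D sigma.
Arguments IOCG n D sigma _ _ : clear implicits.

(* D_i = {d in D : the 2-adic valuation of n / d is i} *)
Definition D_val (n : nat) (D : {fset nat}) (i : nat) : {fset nat} :=
  [fset d in D | logn 2 (n %/ d) == i]%fset.

(* Main.v *)
Require Import Defs.
From mathcomp Require Import all_boot all_order all_algebra finmap.
From mathcomp Require Import all_classical all_reals all_analysis.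
From mathcomp Require Import complex.
From mathcomp Require Import zify ring lra.

(** Write N = n/4, index the divisor d of N by e = N/d, and let W e be
    sigma d if d lies in D and 0 otherwise.

    The graph is a Cayley graph of Z/n, so its Hermitian adjacency matrix is
    diagonalised by the characters of Z/n, and the eigenvalue 0 belongs to the
    trivial character.  Hence transfer from u to v at time t means exactly
    that exp(i t lambda_k) = zeta^(k(v-u)) for all k ([circulant_pst_iff]).
    Since zeta^N = i, the transfers inside a coset of N Z/n all follow from
    the one from b to b+N, by multiplying the time by an integer, and
    statement (i) says that some t satisfies exp(i t lambda_k) = i^k for all k
    ([IOCG_mst_iff]).

    The eigenvalues come from geometric sums alone.  With chi the nontrivial
    character modulo 4, the signed indicator of the connection set is
    c |-> W(N/g) chi(c/g), g = gcd(c,n), and 0 where g does not divide N.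
    Solving a triangular system ([chi4_inversion]) rewrites it as an integral
    combination, with coefficients Phi(e), of the functions
    c |-> [d | c] chi(c/d), d = N/e, whose Fourier transforms are geometric
    sums.  This gives lambda_k = 2 sum over e | gcd(N,k) of Phi(e) e chi(k/e)
    ([connection_sign_fourier]), where Phi and W determine each other and,
    because chi vanishes on even numbers, only indices e with the same 2-adic
    valuation interact.

    If W is supported on e = 1 among odd e, and on e = 2 among twice odd e,
    then Phi is too, so lambda_k is +-2 chi(k), +-4 or a multiple of 8
    according to k mod 4, and t = +-pi/4 works ([transfer_sufficient]).

    Conversely, put a = 0 or 1.  The transfer equations give a real s with
    exp(i s lambda_k / 2) = -1 for all k = 2^a q < n, q odd, and this forces all
    these integers lambda_k / 2 to have the same 2-adic valuation
    ([cisN1_valuation]).  They are in particular nonzero, so 2^a divides N.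
    Read from e = 2^a upwards, the triangular formula for lambda then shows
    that Phi(2^a q) is even for odd q > 1; so W(2^a q) is even, hence 0
    ([weight_single]).  The conditions for a = 0 and a = 1 are those on D_2
    and D_3. *)

Import Order.TTheory GRing.Theory Num.Theory.
Import numFieldNormedType.Exports.

Local Open Scope ring_scope.
Local Open Scope complex_scope.

(** * The character modulo 4 and a triangular inversion over divisors *)

Definition chi4 (k : nat) : int := (k %% 4 == 1)%N%:R - (k %% 4 == 3)%N%:R.

Lemma chi4_mod k : chi4 (k %% 4) = chi4 k.
Proof. by rewrite /chi4 modn_mod. Qed.

Lemma chi4M a b : chi4 (a * b) = chi4 a * chi4 b.
Proof.
rewrite -(chi4_mod a) -(chi4_mod b) -chi4_mod -modnMml -modnMmr.
have := ltn_pmod a (isT : 0 < 4)%N; have := ltn_pmod b (isT : 0 < 4)%N.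
by case: (a %% 4)%N => [|[|[|[]]]] //; case: (b %% 4)%N => [|[|[|[]]]].
Qed.

Lemma chi4_even k : ~~ odd k -> chi4 k = 0.
Proof.
rewrite -chi4_mod -(@odd_mod k 4) //.
have := ltn_pmod k (isT : 0 < 4)%N.
by case: (k %% 4)%N => [|[|[|[]]]].
Qed.

Lemma chi4_odd k : odd k -> chi4 k = 1 \/ chi4 k = -1.
Proof.
rewrite -chi4_mod -(@odd_mod k 4) //.
have := ltn_pmod k (isT : 0 < 4)%N.
by case: (k %% 4)%N => [|[|[|[]]]] //; [left|right].
Qed.

Lemma sum_divisorsD1 (N e : nat) (P : pred nat) (F : nat -> int) :
    (0 < N)%N -> (e %| N)%N -> P e ->
  \sum_(f <- divisors N | P f) F f =
  F e + \sum_(f <- divisors N | P f && (f != e)) F f.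
Proof.
move=> N0 eN Pe; rewrite -big_filter (bigD1_seq e) ?filter_uniq ?divisors_uniq //=.
  by rewrite big_filter_cond.
by rewrite mem_filter Pe -dvdn_divisors.
Qed.

(** The system is unitriangular for divisibility, hence solvable over the
    integers by descending induction on e: a Moebius inversion twisted by
    chi4. *)
Lemma chi4_inversion (N : nat) (W : nat -> int) : (0 < N)%N ->
  exists Phi : nat -> int, forall e, (e %| N)%N ->
    W e = \sum_(f <- divisors N | (e %| f)%N) Phi f * chi4 (f %/ e).
Proof.
move=> N0.
suff H k : exists Phi : nat -> int, forall e, (e %| N)%N -> (N < e + k)%N ->
    W e = \sum_(f <- divisors N | (e %| f)%N) Phi f * chi4 (f %/ e).
  have [Phi HP] := H N.+1; exists Phi => e eN; apply: HP => //.
  by rewrite addnS ltnS leq_addl.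
elim: k => [|k [Phi IH]].
  exists (fun=> 0) => e eN; rewrite addn0 => Ne.
  by have := dvdn_leq N0 eN; rewrite leqNgt Ne.
(* e0 is the next index to solve for; its equation determines Phi e0, and e0
   occurs in no equation of larger index. *)
pose e0 := (N - k)%N.
pose v := W e0 - \sum_(f <- divisors N | (e0 %| f)%N && (f != e0))
                   Phi f * chi4 (f %/ e0).
exists (fun f => if f == e0 then v else Phi f) => e eN.
have e_gt0 : (0 < e)%N by apply: dvdn_gt0 eN.
rewrite addnS ltnS leq_eqVlt => /orP[/eqP Ne|Ne].
  have e0E : e = e0 by rewrite /e0 Ne addnK.
  have e00 : (0 < e0)%N by rewrite -e0E.
  have e0N : (e0 %| N)%N by rewrite -e0E.
  rewrite e0E (sum_divisorsD1 N e0) ?dvdnn // eqxx divnn e00 mulr1 /v.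
  rewrite [X in _ = _ + X](eq_bigr (fun f => Phi f * chi4 (f %/ e0))) ?subrK //.
  by move=> f /andP[_ /negbTE ->].
rewrite (IH e eN Ne); rewrite big_seq_cond [RHS]big_seq_cond.
apply: eq_bigr => f /andP[]; rewrite -dvdn_divisors // => fN ef.
case: eqP => // fe; have := dvdn_leq (dvdn_gt0 N0 fN) ef; rewrite fe /e0.
lia.
Qed.

(** Half the eigenvalue attached to the character k |-> zeta^(jk), once the
    weights have been turned into the coefficients Phi. *)
Definition half_eigenvalue (N : nat) (Phi : nat -> int) (j : nat) : int :=
  \sum_(e <- divisors N | (e %| j)%N) Phi e * e%:Z * chi4 (j %/ e).

Section TriangularSystem.
Variables (N : nat) (W Phi : nat -> int).
Hypothesis N0 : (0 < N)%N.
Hypothesis weightE : forall e, (e %| N)%N ->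
  W e = \sum_(f <- divisors N | (e %| f)%N) Phi f * chi4 (f %/ e).

Lemma weight_eq_coef e : (e %| N)%N ->
  (forall k, odd k -> (1 < k)%N -> (e * k %| N)%N -> Phi (e * k)%N = 0) ->
  W e = Phi e.
Proof.
move=> eN H; have e0 := dvdn_gt0 N0 eN.
rewrite weightE // (sum_divisorsD1 N e) ?dvdnn // divnn e0 mulr1.
rewrite big_seq_cond big1 ?addr0 // => f /and3P[]; rewrite -dvdn_divisors //.
move=> fN /dvdnP[k def_f]; rewrite {}def_f mulnC in fN * => kn.
rewrite mulKn //; case ok: (odd k); last by rewrite chi4_even ?ok ?mulr0.
rewrite H ?mul0r //; case: k ok kn fN => [|[|k]] //.
by rewrite muln1 eqxx.
Qed.

(** Only multiples of e by odd numbers enter the equation for W e, so Phi is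
    solved for inside each such chain, starting from its largest member. *)
Lemma coef_eq0 e : (e %| N)%N ->
  (forall k, odd k -> (e * k %| N)%N -> W (e * k)%N = 0) -> Phi e = 0.
Proof.
have [m] := ubnP (N - e); elim: m e => // m IH e; rewrite ltnS => Nem eN H.
have e0 := dvdn_gt0 N0 eN.
rewrite -weight_eq_coef //; first by have := H 1%N; rewrite muln1; apply.
move=> k ok k1 ekN; apply: IH => //.
  have : (e * k <= N)%N by apply: dvdn_leq.
  have : (e < e * k)%N by rewrite ltn_Pmulr.
  lia.
by move=> l ol; rewrite -mulnA; apply: H; rewrite oddM ok.
Qed.

Lemma coef_eq_weight e : (e %| N)%N ->
  (forall k, odd k -> (1 < k)%N -> (e * k %| N)%N -> W (e * k)%N = 0) ->
  Phi e = W e.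
Proof.
move=> eN H; apply/esym/weight_eq_coef => // k ok k1 ekN.
apply: coef_eq0 => // l ol; rewrite -mulnA; apply: H.
  by rewrite oddM ok.
by case: l ol => // l _; rewrite mulnS ltn_addr.
Qed.

(** As chi4 kills even cofactors, in the formula for index 2^a q only divisors
    of the form 2^a r, with r dividing q, contribute. *)
Lemma dvd_odd_cofactor a q e : odd q -> (e %| 2 ^ a * q)%N ->
  odd ((2 ^ a * q) %/ e) -> exists2 r, e = (2 ^ a * r)%N & (r %| q)%N.
Proof.
move=> oq /dvdnP[k def_k] ok.
have q0 : (0 < q)%N by case: q oq {def_k ok}.
have p0 : (0 < 2 ^ a * q)%N by rewrite muln_gt0 expn_gt0.
have e0 : (0 < e)%N by move: p0; rewrite def_k; case: e {def_k ok}; rewrite ?muln0.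
rewrite def_k mulnK // in ok.
have : (2 ^ a %| e)%N.
  rewrite -(@Gauss_dvdr _ k); first by rewrite -def_k dvdn_mulr.
  by rewrite coprimeXl // coprime2n.
case/dvdnP=> r def_e; exists r; first by rewrite mulnC.
move/eqP: def_k; rewrite def_e mulnA mulnC eqn_mul2r.
by rewrite expn_eq0 /= => /eqP ->; rewrite dvdn_mull.
Qed.

Lemma half_eigenvalue_pow2 a q : odd q ->
  half_eigenvalue N Phi (2 ^ a * q) =
  \sum_(e <- divisors N | [&& (e %| 2 ^ a * q)%N, odd ((2 ^ a * q) %/ e)
      & (2 ^ a %| e)%N]) Phi e * e%:Z * chi4 ((2 ^ a * q) %/ e).
Proof.
move=> oq; rewrite /half_eigenvalue.
rewrite (bigID (fun e => odd ((2 ^ a * q) %/ e))) /= [X in _ + X]big1 ?addr0.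
  apply: eq_bigl => e; apply/andP/and3P => [[eq o]|[eq o _]]; last by split.
  by split=> //; have [r -> _] := dvd_odd_cofactor _ _ _ oq eq o; rewrite dvdn_mulr.
by move=> e /andP[_ o]; rewrite chi4_even ?mulr0.
Qed.

Lemma half_eigenvalue_single a q : (2 ^ a %| N)%N -> odd q ->
  (forall k, odd k -> (1 < k)%N -> (2 ^ a * k %| N)%N -> W (2 ^ a * k)%N = 0) ->
  half_eigenvalue N Phi (2 ^ a * q) = W (2 ^ a)%N * (2 ^ a)%:Z * chi4 q.
Proof.
move=> aN oq H; have p0 : (0 < 2 ^ a)%N by rewrite expn_gt0.
rewrite half_eigenvalue_pow2 // (sum_divisorsD1 N (2 ^ a)%N) //; last first.
  by rewrite mulKn // oq dvdn_mulr ?dvdnn.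
rewrite big_seq_cond big1 ?addr0.
  by rewrite coef_eq_weight // mulKn.
move=> e; rewrite -dvdn_divisors // => /and3P[eN /and3P[eq o ae] ne].
have [r def_e rq] := dvd_odd_cofactor _ _ _ oq eq o.
rewrite def_e coef_eq0 ?mul0r -?def_e // => k ok; rewrite def_e -mulnA => rkN.
have odr : odd r by apply: dvdn_odd rq oq.
apply: H => //; first by rewrite oddM odr.
case: (r =P 1%N) => r1; first by rewrite def_e r1 muln1 eqxx in ne.
case: k ok {rkN} => // k _; rewrite mulnS ltn_addr //.
by case: r r1 odr {def_e rq} => [|[]].
Qed.

(** A term survives only if j/e is odd, and then 4 divides the factor e. *)
Lemma half_eigenvalue_dvd4 j : (4 %| j)%N -> (4 %| half_eigenvalue N Phi j)%Z.
Proof.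
move=> j4; rewrite /half_eigenvalue; apply: rpred_sum => e ej.
case o: (odd (j %/ e)); last by rewrite chi4_even ?o ?mulr0 ?dvdz0.
rewrite dvdz_mulr // dvdz_mull // -[4]/(Posz 4) dvdzE /=.
rewrite -(@Gauss_dvdr 4 (j %/ e)) ?divnK //.
by rewrite -[4%N]/(2 ^ 2)%N coprimeXl // coprime2n.
Qed.

Hypothesis W_even : forall e, (2 %| W e)%Z -> W e = 0.

(** The 2-adic heart of the necessity.  At index 2^a q the formula reads
    Phi(2^a) 2^a + Phi(2^a q) 2^a q + (intermediate terms), up to the signs
    chi4.  All these values being congruent to 2^k modulo 2^(k+1), the
    coefficients Phi(2^a q) 2^a vanish modulo 2^(k+1) for odd q > 1 by
    induction; as a <= k they are even, and the weights, sums of them, too. *)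
Lemma weight_single a (k : nat) : (2 ^ a %| N)%N ->
  (forall q, odd q -> (2 ^ a * q %| N)%N ->
     (2 ^+ k.+1 %| half_eigenvalue N Phi (2 ^ a * q) - 2 ^+ k)%Z) ->
  W (2 ^ a)%N != 0 /\
  forall q, odd q -> (1 < q)%N -> (2 ^ a * q %| N)%N -> W (2 ^ a * q)%N = 0.
Proof.
move=> aN Hk; have p0 : (0 < 2 ^ a)%N by rewrite expn_gt0.
have single : half_eigenvalue N Phi (2 ^ a) = Phi (2 ^ a)%N * (2 ^ a)%:Z.
  have := half_eigenvalue_pow2 a 1 isT; rewrite muln1 => ->.
  rewrite (sum_divisorsD1 N (2 ^ a)%N) ?dvdnn ?divnn ?p0 //.
  rewrite big1 ?addr0 ?mulr1 // => e /andP[/and3P[ea _ ae]].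
  by rewrite eqn_dvd ea ae.
have H1 : (2 ^+ k.+1 %| Phi (2 ^ a)%N * (2 ^ a)%:Z - 2 ^+ k)%Z.
  by rewrite -single; have := Hk 1%N; rewrite muln1; apply.
have N2k : ~~ (2 ^+ k.+1 %| (2 ^+ k : int))%Z.
  apply/negP => /dvdzP[c]; rewrite exprS mulrA -{1}[2 ^+ k]mul1r.
  by move/(mulIf (expf_neq0 _ (isT : (2 : int) != 0))); lia.
have step q : odd q -> (1 < q)%N -> (2 ^ a * q %| N)%N ->
    (2 ^+ k.+1 %| Phi (2 ^ a * q)%N * (2 ^ a)%:Z)%Z.
  have [m] := ubnP q; elim: m q => // m IH q; rewrite ltnS => qm oq q1 qN.
  have cop : coprimez (2 ^+ k.+1) q%:Z.
    by rewrite coprimezE abszX /= coprimeXl // coprime2n.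
  rewrite -(Gauss_dvdzl _ cop).
  have p_lt : ((2 ^ a * q)%N != 2 ^ a)%N.
    by rewrite -{2}[(2 ^ a)%N]muln1 eqn_pmul2l // neq_ltn q1 orbT.
  (* split off e = 2^a and e = 2^a q; the rest is handled by induction *)
  have := Hk q oq qN; rewrite half_eigenvalue_pow2 //.
  rewrite (sum_divisorsD1 N (2 ^ a)%N) //; last first.
    by rewrite mulKn // oq dvdn_mulr ?dvdnn.
  rewrite (sum_divisorsD1 N (2 ^ a * q)%N) //; last first.
    rewrite divnn muln_gt0 p0 dvdnn dvdn_mulr // p_lt.
    by rewrite (ltn_trans _ q1).
  rewrite mulKn // divnn muln_gt0 p0 (ltn_trans _ q1) // mulr1.
  set rest := (X in _ + (_ + X) - _).
  have rest_dvd : (2 ^+ k.+1 %| rest)%Z.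
    rewrite /rest big_seq_cond; apply: rpred_sum => e; rewrite -dvdn_divisors //.
    move=> /andP[eN /andP[/andP[/and3P[eq o ae] ne1] ne2]].
    have [r def_e rq] := dvd_odd_cofactor _ _ _ oq eq o.
    have q0 : (0 < q)%N by apply: ltn_trans q1.
    rewrite dvdz_mulr // def_e PoszM mulrA dvdz_mulr //; apply: IH.
    - apply: leq_trans qm; rewrite ltn_neqAle dvdn_leq // andbT.
      by apply: contraNneq ne2 => <-; rewrite def_e.
    - exact: dvdn_odd rq oq.
    - rewrite ltn_neqAle (dvdn_gt0 q0 rq) andbT.
      by apply: contraNneq ne1 => r1; rewrite def_e -r1 muln1.
    - by rewrite -def_e.
  move: rest_dvd H1; rewrite exprS PoszM; move: (2 ^+ k) => K.
  case/dvdzP=> c1 -> /dvdzP[c2 E2] /dvdzP[c3 E3]; apply/dvdzP.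
  case: (chi4_odd _ oq) E3 => -> E3.
    by exists (c3 - c2 - c1); lia.
  by exists (c3 + c2 - c1 + 1); lia.
(* otherwise 2^(k+1) would divide 2^a, hence 2^k *)
have ak : (a <= k)%N.
  rewrite leqNgt; apply/negP => ka; move/negP: N2k; apply.
  have /dvdzP[c Ec] : (2 ^+ k.+1 %| (2 ^ a)%:Z)%Z.
    by rewrite -[(2 ^ a)%:Z]/((2 ^ a)%N%:Z) -natz natrX; apply: dvdz_exp2l.
  case/dvdzP: H1 => c2 E2; apply/dvdzP; exists (Phi (2 ^ a)%N * c - c2).
  by rewrite mulrBl -E2 Ec; ring.
have Phi_even q : odd q -> (1 < q)%N -> (2 ^ a * q %| N)%N ->
    (2 %| Phi (2 ^ a * q)%N)%Z.
  move=> oq q1 /(step q oq q1).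
  have -> : (2 ^ a)%:Z = 2 ^+ a by rewrite -natz natrX.
  have -> : (2 : int) ^+ k.+1 = 2 ^+ (k - a).+1 * 2 ^+ a.
    by rewrite -exprD addSn subnK.
  by rewrite dvdz_mul2r ?expf_neq0 // exprS; apply: dvdz_trans; apply: dvdz_mulr.
have W0 q : odd q -> (1 < q)%N -> (2 ^ a * q %| N)%N -> W (2 ^ a * q)%N = 0.
  move=> oq q1 qN; apply: W_even; rewrite weightE // big_seq_cond.
  apply: rpred_sum => f; rewrite -dvdn_divisors // => /andP[fN].
  case/dvdnP=> l def_f; rewrite def_f mulnK; last exact: dvdn_gt0 qN.
  case ol: (odd l); last by rewrite chi4_even ?ol ?mulr0 ?dvdz0.
  rewrite dvdz_mulr // mulnC -mulnA Phi_even ?oddM ?oq //.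
    by case: l ol {def_f} => // l _; rewrite mulnS ltn_addr.
  by rewrite mulnA mulnC -def_f.
split=> //; apply: contraNneq N2k => W1; move: H1.
by rewrite coef_eq_weight // W1 mul0r sub0r rpredN.
Qed.
End TriangularSystem.

(** * The complex exponential on the imaginary axis *)

Section Cis.
Variable R : realType.
Implicit Types x y : R.

Definition cis x : R[i] := cos x +i* sin x.

Lemma cis0 : cis 0 = 1.
Proof. by rewrite /cis cos0 sin0. Qed.

Lemma cisD x y : cis (x + y) = cis x * cis y.
Proof.
rewrite /cis cosD sinD; apply/eqP; rewrite eq_complex /= eqxx /=.
by rewrite addrC.
Qed.

Lemma cisMn x k : cis (x *+ k) = cis x ^+ k.
Proof.
elim: k => [|k IH]; first by rewrite mulr0n cis0 expr0.
by rewrite mulrS cisD IH exprS.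
Qed.

Lemma cis_neq0 x : cis x != 0.
Proof.
apply/eqP => E; have := cisD x (- x); rewrite subrr cis0 E mul0r.
by move/eqP; rewrite oner_eq0.
Qed.

Lemma cisN x : cis (- x) = (cis x)^-1.
Proof.
by apply: (mulfI (cis_neq0 x)); rewrite -cisD subrr cis0 divff ?cis_neq0.
Qed.

Lemma cisMz x (k : int) : cis (x *~ k) = cis x ^ k.
Proof.
case: k => k; first by rewrite -pmulrn cisMn.
by rewrite NegzE mulrNz cisN -pmulrn cisMn -exprnN.
Qed.

Lemma cis_pihalf : cis (pi / 2) = 'i.
Proof. by rewrite /cis cos_pihalf sin_pihalf. Qed.

Lemma cis_pi : cis pi = -1.
Proof. by rewrite /cis cospi sinpi; apply/eqP; rewrite eq_complex /= oppr0 !eqxx. Qed.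

Lemma expi k : ('i : R[i]) ^+ k =
  ((~~ odd k)%:R * (-1) ^+ k./2) +i* ((odd k)%:R * (-1) ^+ k.-1./2).
Proof.
have dbl m : ('i : R[i]) ^+ m.*2 = ((-1) ^+ m)%:C.
  by rewrite -mul2n exprM sqr_i rmorphXn rmorphN1.
rewrite -{1}[k]odd_double_half exprD dbl; case ok: (odd k) => /=.
  rewrite mul0r mul1r -[k in RHS]odd_double_half ok /= doubleK expr1.
  apply/eqP; rewrite eq_complex /=.
  by rewrite !mul0r mulr0 !mul1r subr0 add0r !eqxx.
by rewrite expr0 mul0r !mul1r.
Qed.

(** Matching real and imaginary parts term by term with the power series that
    define cosine and sine. *)
Lemma series_expi x :
  series (fun k => (k`!%:R)^-1 * ('i * x%:C : R[i]) ^+ k) =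
  (fun n => series (cos_coeff x) n +i* series (sin_coeff x) n).
Proof.
apply/funext => n; rewrite /series /=; elim: n => [|n IH].
  by rewrite !big_geq.
rewrite !big_nat_recr //= IH.
suff -> : (n`!%:R)^-1 * ('i * x%:C : R[i]) ^+ n = cos_coeff x n +i* sin_coeff x n.
  by [].
rewrite exprMn expi -rmorphXn -(rmorph_nat (real_complex R)) -fmorphV /=.
apply/eqP; rewrite eq_complex /cos_coeff /sin_coeff /=.
by rewrite !mul0r !mulr0 !addr0 !subr0 add0r -exprnP !(mulrC (_^-1)) !eqxx.
Qed.

Lemma cvg_complex (u v : nat -> R) (a b : R) :
  (u @ \oo --> a)%classic -> (v @ \oo --> b)%classic ->
  ((fun n => u n +i* v n : (R[i] : numFieldType)^o) @ \oo
     --> (a +i* b : (R[i] : numFieldType)^o))%classic.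
Proof.
move=> ua vb; apply/cvgrPdist_lt => e e0.
(* e is positive in the partial order of R[i], hence real *)
have [r re] : exists r : R, e = r%:C.
  by move: (ger0_real (ltW e0)) => /complex_realP.
rewrite re ltcR in e0 *.
have r2 : 0 < r / 2 by rewrite divr_gt0.
have /cvgrPdist_lt/(_ _ r2) Hu := ua.
have /cvgrPdist_lt/(_ _ r2) Hv := vb.
near=> n.
have -> : (a +i* b) - (u n +i* v n) = (a - u n)%:C + 'i * (b - v n)%:C :> R[i].
  apply/eqP; rewrite eq_complex /=.
  by rewrite !mul0r !mulr0 mul1r subr0 !addr0 !add0r !eqxx.
apply: le_lt_trans (ler_normD _ _) _.
rewrite normrM.
have nC (z : R) : `|z%:C| = `|z|%:C :> R[i].
  by rewrite normc_def /= expr0n addr0 sqrtr_sqr.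
rewrite !nC -complexiE.
have -> : `|'i : R[i]| = 1 by rewrite normc_def /= expr0n expr1n add0r sqrtr1.
rewrite mul1r -rmorphD ltcR [r]splitr ltrD //.
  by near: n.
by near: n.
Unshelve. all: by end_near. Qed.

Lemma cvg_series_expi x :
  (series (fun k => (k`!%:R)^-1 * ('i * x%:C : R[i]) ^+ k) @ \oo
     --> (cis x : (R[i] : numFieldType)^o))%classic.
Proof.
rewrite series_expi; apply: cvg_complex.
  by rewrite unlock; apply: is_cvg_series_cos_coeff.
by rewrite unlock; apply: is_cvg_series_sin_coeff.
Qed.
End Cis.

Lemma cvg_finite_sum (K : numFieldType) (V : normedModType K) (I : Type)
    (r : seq I) (f : I -> nat -> V) (l : I -> V) :
  (forall i, f i @ \oo --> l i)%classic ->
  ((fun n => \sum_(i <- r) f i n) @ \oo --> \sum_(i <- r) l i)%classic.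
Proof.
move=> fl; elim: r => [|i r IH].
  rewrite big_nil; under eq_fun do rewrite big_nil.
  exact: cvg_cst.
rewrite big_cons; under eq_fun do rewrite big_cons.
exact: cvgD.
Qed.

Section Spectral.
Variables (R : realType) (m p : nat) (P : 'I_p -> 'M[R[i]]_m).
Hypothesis P_idem : forall i j, P i *m P j = if i == j then P i else 0.
Hypothesis P_sum : \sum_i P i = 1%:M.

Lemma spectral_exp (a : 'I_p -> R[i]) k :
  (\sum_i a i *: P i) ^+ k = \sum_i a i ^+ k *: P i.
Proof.
elim: k => [|k IH]; first by
  rewrite expr0 -[LHS]P_sum; apply: eq_bigr => i _; rewrite expr0 scale1r.
rewrite exprS IH -[LHS]/(_ *m _) mulmx_suml; apply: eq_bigr => i _.
rewrite mulmx_sumr (bigD1 i) //= big1 ?addr0.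
  by rewrite -scalemxAl -scalemxAr P_idem eqxx scalerA exprS.
by move=> j ji; rewrite -scalemxAl -scalemxAr P_idem eq_sym (negbTE ji) !scaler0.
Qed.

(** Partial sums of the exponential series act as scalars on each projector,
    so the matrix limit reduces to finitely many scalar limits. *)
Lemma expmx_spectral (x : 'I_p -> R) :
  expmx (\sum_i ('i * (x i)%:C) *: P i) = \sum_i cis R (x i) *: P i.
Proof.
rewrite /expmx; refine (@cvg_lim ('M[(R[i] : numFieldType)]_m)
  (@norm_hausdorff _ ('M[(R[i] : numFieldType)]_m)) nat _ _ _ _ _).
have -> : series (fun k => k`!%:R^-1 *: (\sum_i ('i * (x i)%:C) *: P i) ^+ k) =
   (fun n => \sum_i series (fun k => k`!%:R^-1 * ('i * (x i)%:C) ^+ k) n *: P i).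
  apply/funext => n; rewrite /series /=.
  under eq_bigr do rewrite spectral_exp scaler_sumr.
  rewrite exchange_big /=; apply: eq_bigr => i _; rewrite scaler_suml.
  by apply: eq_bigr => k _; rewrite scalerA.
apply: cvg_finite_sum => i; apply: cvgZr_tmp; exact: cvg_series_expi.
Qed.
End Spectral.

(** * Finite geometric and character sums *)

Lemma chi4_expi (R : realType) q :
  ('i : R[i]) ^+ q - 'i ^+ (3 * q) = 2 * 'i * (chi4 q)%:~R.
Proof.
have i4 : ('i : R[i]) ^+ 4 = 1 by rewrite (exprM _ 2 2) sqr_i sqrrN expr1n.
have e4 k : ('i : R[i]) ^+ k = 'i ^+ (k %% 4) by rewrite -[in LHS](expr_mod k i4).
rewrite e4 [X in _ - X]e4 -modnMmr -chi4_mod.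
have i2 : ('i : R[i]) ^+ 2 = -1 by rewrite sqr_i.
have := ltn_pmod q (isT : 0 < 4)%N.
case: (q %% 4)%N => [|[|[|[|]]]] //= _.
- by rewrite -[chi4 _]/(0 : int) -[(_ %% _)%N]/0%N subrr mulr0.
- rewrite -[chi4 _]/(1 : int) -[(_ %% _)%N]/3%N (exprD _ 2 1) i2 !expr1; ring.
- by rewrite -[chi4 _]/(0 : int) -[(_ %% _)%N]/2%N subrr mulr0.
- rewrite -[chi4 _]/(-1 : int) -[(_ %% _)%N]/1%N (exprD _ 2 1) i2 !expr1; ring.
Qed.

Lemma sum_geometric_root (F : fieldType) (z : F) m : z ^+ m = 1 ->
  \sum_(0 <= l < m) z ^+ l = if z == 1 then m%:R else 0.
Proof.
move=> zm; case: eqP => [->|/eqP z1].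
  under eq_bigr do rewrite expr1n.
  by rewrite big_const_nat iter_addr addr0 subn0.
rewrite big_mkord; apply: (mulfI (x := z - 1)); first by rewrite subr_eq0.
by rewrite -subrX1 zm subrr mulr0.
Qed.

(** Grouping the terms by blocks of four gives a geometric sum in z^4. *)
Lemma sum_chi4 (F : fieldType) (z : F) e : z ^+ (4 * e) = 1 ->
  \sum_(0 <= k < 4 * e) (chi4 k)%:~R * z ^+ k =
  if z ^+ 4 == 1 then e%:R * (z - z ^+ 3) else 0.
Proof.
rewrite mulnC => ze.
rewrite big_nat_mul.
transitivity (\sum_(0 <= l < e) (z ^+ 4) ^+ l * (z - z ^+ 3)).
  apply: eq_bigr => l _.
  rewrite mulSnr -{1}[(l * 4)%N]add0n big_addn addKn 4?big_nat_recl // big_geq //.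
  have cl k : chi4 (k + l * 4) = chi4 k by rewrite -chi4_mod addnC modnMDl chi4_mod.
  rewrite !cl !exprD (mulnC l) exprM /=.
  rewrite -[chi4 0]/(0 : int) -[chi4 1]/(1 : int) -[chi4 2]/(0 : int).
  by rewrite -[chi4 3]/(-1 : int); ring.
rewrite -mulr_suml sum_geometric_root; first by case: ifP; rewrite ?mul0r.
by rewrite -exprM mulnC.
Qed.

Lemma sum_multiples (V : nmodType) (F : nat -> V) d m : (0 < d)%N ->
  \sum_(0 <= c < d * m | (d %| c)%N) F c = \sum_(0 <= k < m) F (d * k)%N.
Proof.
move=> d0; rewrite mulnC big_mkcond /= big_nat_mul; apply: eq_bigr => k _.
rewrite mulSnr -{1}[(k * d)%N]add0n big_addn addKn -{1}(prednK d0).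
rewrite big_nat_recl // add0n dvdn_mull // [in RHS]mulnC.
rewrite big_nat_cond big1 /=; first by rewrite addr0.
move=> i; rewrite andbT /= => ilt.
by rewrite dvdn_addl ?dvdn_mull // gtnNdvd //; move: ilt; lia.
Qed.

(** * Circulant graphs: diagonalisation and perfect state transfer *)

Section Root.
Variables (R : realType) (n : nat).
Hypothesis n0 : (0 < n)%N.

Definition zeta : R[i] := cis R (pi *+ 2 / n%:R).

Lemma zetaX k : zeta ^+ k = cis R (pi *+ 2 / n%:R *+ k).
Proof. by rewrite cisMn. Qed.

Lemma zeta_n : zeta ^+ n = 1.
Proof.
rewrite zetaX -mulrnAr -mulr_natr mulVf ?pnatr_eq0 -?lt0n // mulr1.
by rewrite cisMn cis_pi sqrrN expr1n.
Qed.

Lemma zeta_mod k : zeta ^+ (k %% n) = zeta ^+ k.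
Proof. by rewrite expr_mod // zeta_n. Qed.

Lemma zeta_eq1 k : (zeta ^+ k == 1) = (n %| k)%N.
Proof.
rewrite -zeta_mod /dvdn; have := ltn_pmod k n0.
case: (k %% n)%N => [|l] ln; first by rewrite expr0 !eqxx.
apply/eqP; rewrite zetaX => -[c1 _].
(* 0 < x / 2 < pi, so cos x = 1 - 2 sin^2 (x / 2) < 1 *)
set x : R := pi *+ 2 / n%:R *+ l.+1 in c1.
have xE : x = (x / 2) *+ 2 by rewrite -[RHS]mulr_natr divfK.
have n0' : (0 : R) < n%:R by rewrite ltr0n.
have : 0 < sin (x / 2).
  apply: sin_gt0_pi; have -> : x / 2 = pi * (l.+1%:R / n%:R).
    by rewrite /x -mulr_natr -(mulr_natr pi); field; rewrite lt0r_neq0.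
  rewrite mulr_gt0 ?pi_gt0 ?divr_gt0 ?ltr0n //=.
  by rewrite gtr_pMr ?pi_gt0 // ltr_pdivrMr // mul1r ltr_nat.
move=> s0; move: c1; rewrite xE cos_mulr2n cos2sin2.
have := mulr_gt0 s0 s0; nra.
Qed.

Lemma zeta_quarter N : n = (4 * N)%N -> zeta ^+ N = 'i.
Proof.
move=> nE; rewrite zetaX -cis_pihalf; congr cis.
have N0 : (N%:R : R) != 0 by rewrite pnatr_eq0; apply: contraTneq n0; rewrite nE => ->.
by rewrite nE natrM -mulr_natr -(mulr_natr pi); field.
Qed.
End Root.

Section Circulant.
Variables (R : realType) (p : nat).
Notation w := (zeta R p.+2).
Implicit Types (j u v : 'I_p.+2).

(** The order of the cyclic group is written p.+2 so that 'Z_(p.+2) and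
    'I_p.+2, with their ring structures, coincide by conversion. *)
Definition zchar j u : R[i] := w ^+ (j * u)%N.

Lemma zcharC j u : zchar j u = zchar u j.
Proof. by rewrite /zchar mulnC. Qed.

Lemma zcharDr j u v : zchar j (u + v) = zchar j u * zchar j v.
Proof.
by rewrite /zchar -zeta_mod //= modnMmr zeta_mod // mulnDr exprD.
Qed.

Lemma zchar0r j : zchar j 0 = 1.
Proof. by rewrite /zchar muln0 expr0. Qed.

Lemma zcharNr j u : zchar j (- u) * zchar j u = 1.
Proof. by rewrite -zcharDr addNr zchar0r. Qed.

Lemma zchar_neq0 j u : zchar j u != 0.
Proof. by rewrite /zchar expf_neq0 // cis_neq0. Qed.

Lemma zcharNl j u : zchar (- j) u = zchar j (- u).
Proof.
apply: (mulIf (zchar_neq0 j u)).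
by rewrite zcharNr (zcharC (- j)) (zcharC j) zcharNr.
Qed.

Lemma sum_zchar u : \sum_j zchar j u = if u == 0 then p.+2%:R else 0.
Proof.
have -> : \sum_j zchar j u = \sum_(0 <= l < p.+2) (w ^+ u) ^+ l.
  by rewrite big_mkord; apply: eq_bigr => j _; rewrite /zchar mulnC exprM.
rewrite sum_geometric_root; last by rewrite exprAC zeta_n // expr1n.
rewrite zeta_eq1 //; congr (if _ then _ else _); rewrite -val_eqE /=.
by rewrite /dvdn modn_small.
Qed.

Definition fourier_proj j : 'M[R[i]]_p.+2 :=
  \matrix_(u, v) (p.+2%:R^-1 * zchar j (v - u)).

Lemma natrS2_neq0 : p.+2%:R != 0 :> R[i].
Proof. by rewrite pnatr_eq0. Qed.

Lemma fourier_proj_idem i j :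
  fourier_proj i *m fourier_proj j = if i == j then fourier_proj i else 0.
Proof.
apply/matrixP => u v; rewrite mxE.
transitivity (p.+2%:R^-1 ^+ 2 * zchar i (- u) * zchar j v *
   \sum_k zchar k (i - j)).
  rewrite mulr_sumr; apply: eq_bigr => k _; rewrite !mxE !zcharDr.
  rewrite !(zcharC k) zcharNl; ring.
rewrite sum_zchar subr_eq0; case: eqP => [<-|_]; rewrite !mxE ?mulr0 //.
rewrite zcharDr; have := natrS2_neq0; move: p.+2%:R => c c0; by field.
Qed.

Lemma fourier_proj_sum : \sum_j fourier_proj j = 1%:M.
Proof.
apply/matrixP => u v; rewrite summxE !mxE.
under eq_bigr do rewrite mxE.
rewrite -mulr_sumr sum_zchar subr_eq0 (eq_sym v).
by case: eqP => _; rewrite ?mulr0 // mulVf ?natrS2_neq0.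
Qed.

Variables (arc : rel 'I_p.+2) (h : 'I_p.+2 -> int) (lam : 'I_p.+2 -> R).
Hypothesis h_arc : forall u v,
  hermitian_adj R arc u v = 'i * (h (v - u))%:~R.
Hypothesis h_odd : forall u, h (- u) = - h u.
Hypothesis h_fourier : forall j,
  \sum_u (h u)%:~R * zchar j u = 'i * (lam j)%:C.

Lemma adj_spectral :
  hermitian_adj R arc = \sum_j (lam j)%:C *: fourier_proj j.
Proof.
have i2 : 'i * 'i = -1 :> R[i] by rewrite -expr2 sqr_i.
apply/matrixP => u v; rewrite h_arc summxE.
apply: (mulfI (x := 'i%C)); first by rewrite complexiE neq0Ci.
rewrite mulrA i2 mulN1r mulr_sumr.
(* Fourier inversion: only k = u - v survives in the sum over j. *)
transitivity (\sum_k (h k)%:~R * (p.+2%:R^-1 * \sum_j zchar j (k + (v - u))) : R[i]).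
  under eq_bigr do rewrite sum_zchar.
  rewrite (bigD1 (u - v)) //= big1 ?addr0.
    rewrite addrA subrK subrr eqxx mulVf ?natrS2_neq0 // mulr1.
    by rewrite -(opprB v) h_odd mulrNz.
  move=> k kne; rewrite ifF ?mulr0 //.
  by apply: contraNF kne; rewrite -(opprB u) subr_eq0.
under eq_bigr do rewrite !mulr_sumr.
rewrite exchange_big /=; apply: eq_bigr => j _.
rewrite !mxE mulrA -h_fourier mulr_suml; apply: eq_bigr => k _.
rewrite zcharDr; ring.
Qed.

Lemma transition_mx_spectral (t : R) :
  transition_mx arc t = \sum_j cis R (t * lam j) *: fourier_proj j.
Proof.
rewrite /transition_mx adj_spectral scaler_sumr.
rewrite -(expmx_spectral _ _ _ _ fourier_proj_idem fourier_proj_sum).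
congr expmx; apply: eq_bigr => j _; rewrite scalerA -complexiE.
by rewrite -mulrA -rmorphM.
Qed.

(** Pairing the evolved basis vector with a character isolates one
    eigenvalue. *)
Lemma transition_mx_delta (t : R) u k :
  \sum_x zchar k x * (transition_mx arc t *m delta_mx u 0 : 'cV[R[i]]_p.+2) x 0
  = cis R (t * lam k) * zchar k u.
Proof.
have n0 := natrS2_neq0.
transitivity (\sum_j cis R (t * lam j) * zchar j u *
    (p.+2%:R^-1 * \sum_x zchar x (k - j))).
  under [RHS]eq_bigr do rewrite !mulr_sumr.
  rewrite exchange_big /=; apply: eq_bigr => x _.
  rewrite -colE mxE transition_mx_spectral summxE mulr_sumr.
  apply: eq_bigr => j _; rewrite !mxE !zcharDr (zcharC x k).
  rewrite -zcharNl zcharC [zchar (- j) x]zcharC; ring.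
rewrite (bigD1 k) //= subrr sum_zchar eqxx mulVf // mulr1 big1 ?addr0 //.
move=> j jk; rewrite sum_zchar subr_eq0 eq_sym (negbTE jk) !mulr0 //.
Qed.

Hypothesis lam0 : lam 0 = 0.

(** The phase of the transfer is read off the trivial character: the
    eigenvalue there is 0, so it is 1. *)
Lemma circulant_pst_iff u v : perfect_state_transfer R arc u v <->
  exists t, forall k, cis R (t * lam k) = zchar k (v - u).
Proof.
split=> [[t [g [g1 Ug]]]|[t Ht]]; exists t.
  have E k : cis R (t * lam k) * zchar k u = g * zchar k v.
    rewrite -transition_mx_delta Ug (bigD1 v) //= big1 ?addr0.
      by rewrite !mxE !eqxx mulr1 mulrC.
    by move=> x /negbTE xv; rewrite !mxE xv !mulr0.
  have g_1 : g = 1.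
    have := E 0; rewrite lam0 mulr0 cis0 !(zcharC 0) !zchar0r !mulr1.
    by move=> <-.
  move=> k; apply: (mulIf (zchar_neq0 k u)).
  by rewrite E g_1 mul1r -zcharDr subrK.
exists 1; split; first exact: normr1.
rewrite scale1r -colE transition_mx_spectral; apply/colP => x.
rewrite mxE summxE.
transitivity (p.+2%:R^-1 * \sum_j zchar j (v - x)).
  rewrite mulr_sumr; apply: eq_bigr => j _; rewrite !mxE Ht mulrCA -zcharDr.
  by rewrite addrA subrK.
rewrite sum_zchar subr_eq0 !mxE eqxx andbT (eq_sym v).
by case: eqP => _; rewrite ?mulr0 // mulVf ?natrS2_neq0.
Qed.

End Circulant.

(** * The signed indicator of the connection set *)

Lemma in_bigcup_seq (T : finType) (I : eqType) (s : seq I) (F : I -> {set T}) x :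
  (x \in \bigcup_(i <- s) F i)%SET = has (fun i => x \in F i) s.
Proof. by elim: s => [|i s IH]; rewrite ?big_nil ?inE // big_cons inE IH. Qed.

Lemma chi4_eq1 k : (chi4 k == 1) = (k == 1 %[mod 4])%N.
Proof.
rewrite -chi4_mod; have := ltn_pmod k (isT : 0 < 4)%N.
by case: (k %% 4)%N => [|[|[|[|]]]].
Qed.

Lemma chi4_eqN1 k : (chi4 k == -1) = (k == 3 %[mod 4])%N.
Proof.
rewrite -chi4_mod; have := ltn_pmod k (isT : 0 < 4)%N.
by case: (k %% 4)%N => [|[|[|[|]]]].
Qed.

Lemma gcdn_subl a m : (a <= m)%N -> gcdn (m - a) m = gcdn a m.
Proof.
move=> am; have := subnK am; move: (m - a)%N => b <-.
by rewrite gcdnDl addnC gcdnDl gcdnC.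
Qed.

(** If a/g were even, with m/g even as well, then 2g would divide both a and
    m, hence their gcd g. *)
Lemma odd_div_gcdn a m : (0 < gcdn a m)%N -> (2 %| m %/ gcdn a m)%N ->
  odd (a %/ gcdn a m).
Proof.
set g := gcdn a m => g0 m2; rewrite -[odd _]negbK -dvdn2; apply/negP => a2.
have : (2 * g %| g)%N.
  rewrite {2}/g dvdn_gcd -(@dvdn_divRL g _ a) ?dvdn_gcdl // a2.
  by rewrite -(@dvdn_divRL g _ m) ?dvdn_gcdr.
by move/(dvdn_leq g0); lia.
Qed.

Section Connection.
Variables (p : nat) (D : {fset nat}) (sigma : nat -> int).
Hypothesis n4 : (4 %| p.+2)%N.
Hypothesis D_div : forall d, d \in D -> (d %| p.+2 %/ 4)%N.
Hypothesis sigma_pm1 : forall d, d \in D -> sigma d = 1 \/ sigma d = -1.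

Lemma dvd4_quotient d : (d %| p.+2 %/ 4)%N -> (4 %| p.+2 %/ d)%N.
Proof.
case/dvdnP=> q qE; have nE : p.+2 = (4 * q * d)%N.
  by rewrite -mulnA -qE mulnC divnK.
have d0 : (0 < d)%N by case: d {qE} nE => //; rewrite muln0.
by rewrite nE mulnK // dvdn_mulr.
Qed.

Lemma dvd_quarter d : (d %| p.+2 %/ 4)%N -> (d %| p.+2)%N.
Proof. by move/dvdn_trans; apply; rewrite -{2}(divnK n4) dvdn_mulr. Qed.

Lemma in_G_set r d (c : 'I_p.+2) : (d %| p.+2 %/ 4)%N ->
  (c \in G_set p.+2 r d) = (gcdn c p.+2 == d) && (c %/ d == r %[mod 4])%N.
Proof.
move=> dN; have dn := dvd_quarter _ dN; have d4 := dvd4_quotient _ dN.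
have d0 : (0 < d)%N by apply: dvdn_gt0 dn.
apply/imsetP/andP => [[k]|[/eqP gE cr]].
  rewrite inE => /andP[kr gk] cE.
  have -> : (c : nat) = (d * k %% p.+2)%N by rewrite cE; apply: (@val_Zp_nat p.+2).
  rewrite gcdn_modl gk; split=> //.
  by rewrite -{2}(divnK dn) [(_ * d)%N]mulnC -muln_modr mulKn // modn_dvdm.
have dc : (d %| c)%N by rewrite -gE dvdn_gcdl.
have kn : (c %/ d < p.+2)%N by apply: leq_ltn_trans (leq_div _ _) (ltn_ord c).
exists (Ordinal kn); first by rewrite inE /= cr mulnC divnK // gE eqxx.
apply: val_inj; rewrite [RHS](@val_Zp_nat p.+2) //= mulnC divnK //.
by rewrite modn_small.
Qed.

Definition weight (d : nat) : int := if d \in D then sigma d else 0.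

Lemma in_connection_set (c : 'I_p.+2) :
  (c \in connection_set p.+2 D sigma) =
  (weight (gcdn c p.+2) * chi4 (c %/ gcdn c p.+2) == 1).
Proof.
rewrite /connection_set in_bigcup_seq /weight.
apply/hasP/idP => [[d dD]|].
  rewrite /S_set; case: ifP => [/eqP s1|s1]; rewrite in_G_set ?D_div //.
    by case/andP=> /eqP -> cr; rewrite dD s1 mul1r chi4_eq1.
  case: (sigma_pm1 d dD) => sd; first by rewrite sd eqxx in s1.
  by case/andP=> /eqP ->; rewrite -chi4_eqN1 dD sd => /eqP ->.
case: ifP => [gD|]; last by rewrite mul0r.
move=> H; exists (gcdn c p.+2) => //; rewrite /S_set.
case: (sigma_pm1 _ gD) H => ->; rewrite ?mul1r ?mulN1r in_G_set ?D_div // eqxx /=.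
  by rewrite chi4_eq1.
by rewrite eqr_oppLR chi4_eqN1.
Qed.

Definition connection_sign (c : 'I_p.+2) : int :=
  weight (gcdn c p.+2) * chi4 (c %/ gcdn c p.+2).

(** Negation preserves the gcd g with n and sends c/g to n/g - c/g; as
    n/g is a multiple of 4, chi4 changes sign.  So the arcs given by D and
    sigma are never opposite, and the graph is oriented. *)
Lemma connection_signN c : connection_sign (- c) = - connection_sign c.
Proof.
rewrite /connection_sign /=.
rewrite gcdn_modl; case: (eqVneq (c : nat) 0%N) => [c0|c0].
  rewrite c0 subn0 modnn div0n gcd0n gcdnn /weight.
  case: ifP => [/D_div|]; last by rewrite !mul0r oppr0.
  by move/dvdn_leq; rewrite divn_gt0 // dvdn_leq // leqNgt ltn_Pdiv // => /(_ isT).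
have clt := ltn_ord c.
rewrite modn_small; last by rewrite ltn_subrL lt0n c0.
have gE := gcdn_subl c p.+2 (ltnW clt).
rewrite gE /weight; case: ifP => gD; last by rewrite !mul0r oppr0.
rewrite -mulrN; congr (_ * _); set g := gcdn _ _ in gD *.
have g4 := dvd4_quotient _ (D_div _ gD).
rewrite divnBl ?dvdn_gcdr // dvdn_gcdl subn0.
have : (c %/ g <= p.+2 %/ g)%N by rewrite leq_div2r // ltnW.
case/dvdnP: g4 => q ->; move: (c %/ g)%N => x xq.
have -> : chi4 x = - chi4 (3 * x) by rewrite chi4M mulN1r opprK.
rewrite opprK -chi4_mod -[RHS]chi4_mod; congr chi4.
lia.
Qed.

Lemma hermitian_adj_IOCG (R : realType) (u v : 'I_p.+2) :
  @hermitian_adj R p.+2 (IOCG p.+2 D sigma) u v = 'i * (connection_sign (v - u))%:~R.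
Proof.
rewrite mxE /IOCG !in_connection_set -!/(connection_sign _) -complexiE.
rewrite -(opprB v u) connection_signN eqr_oppLR.
have : [\/ connection_sign (v - u) = 0, connection_sign (v - u) = 1
        | connection_sign (v - u) = -1].
  rewrite /connection_sign /weight; case: ifP => gD; last by rewrite mul0r; constructor 1.
  have o : odd ((v - u)%R %/ gcdn (v - u)%R p.+2).
    apply: odd_div_gcdn; first by rewrite gcdn_gt0 orbT.
    by apply: dvdn_trans (dvd4_quotient _ (D_div _ gD)).
  by case: (sigma_pm1 _ gD) => ->; case: (chi4_odd _ o) => ->;
    [constructor 2|constructor 3|constructor 3|constructor 2].
by case=> -> /=; rewrite ?mulr0 ?mulr1 // mulrN1.
Qed.
End Connection.

(** * The integer eigenvalues *)

Lemma divn_quotient m d : (0 < m)%N -> (d %| m)%N -> (m %/ (m %/ d) = d)%N.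
Proof. by move=> m0 dm; rewrite divnA // mulKn. Qed.

Lemma dvdn_quotientC m a b : (0 < m)%N -> (a %| m)%N -> (b %| m)%N ->
  (m %/ a %| b)%N = (m %/ b %| a)%N.
Proof.
move=> m0 am bm.
rewrite -(dvdn_pmul2r (dvdn_gt0 m0 (dvdn_div bm))) [(b * _)%N]mulnC divnK //.
rewrite -[X in (_ %| X)%N](divnK am) dvdn_pmul2l //.
exact: dvdn_gt0 (dvdn_div am).
Qed.

(** As c/d is odd, c has no more factors 2 than m, and the factor 4 does not
    contribute to the gcd. *)
Lemma gcdn_quarter_dvd c m d : (d %| c)%N -> (d %| m)%N -> odd (c %/ d) ->
  (gcdn c (4 * m) %| m)%N.
Proof.
case/dvdnP=> x ->; case/dvdnP=> e ->; case: (posnP d) => [->|d0].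
  by rewrite !muln0.
rewrite mulnK // mulnA -muln_gcdl => ox; apply: dvdn_mul => //.
rewrite Gauss_gcdr ?dvdn_gcdr // -[4%N]/(2 ^ 2)%N coprimeXr // coprimen2 //.
Qed.

Section Eigen.
Variables (R : realType) (p : nat) (D : {fset nat}) (sigma : nat -> int).
Hypothesis n4 : (4 %| p.+2)%N.
Hypothesis D_div : forall d, d \in D -> (d %| p.+2 %/ 4)%N.
Variables (N : nat) (Phi : nat -> int).
Hypothesis NE : p.+2 = (4 * N)%N.
Hypothesis Phi_weight : forall e, (e %| N)%N ->
  weight D sigma (N %/ e) =
  \sum_(f <- divisors N | (e %| f)%N) Phi f * chi4 (f %/ e).

Lemma N_gt0 : (0 < N)%N.
Proof. by case: N NE; rewrite ?muln0. Qed.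

Lemma N_dvd : (N %| p.+2)%N. Proof. by rewrite NE dvdn_mull. Qed.

(** If g = gcd(c,n) divides N, then chi4(c/d) = chi4(c/g) chi4(g/d) for
    d = N/e dividing c, and the defining equation of Phi at N/g applies.
    Otherwise c is divisible by a higher power of 2 than N, and both sides
    vanish. *)
Lemma connection_sign_expand (c : 'I_p.+2) :
  connection_sign p D sigma c =
  \sum_(e <- divisors N | (N %/ e %| c)%N) Phi e * chi4 (c %/ (N %/ e)).
Proof.
have N0 := N_gt0; rewrite /connection_sign; set g := gcdn c p.+2.
have g0 : (0 < g)%N by rewrite gcdn_gt0 orbT.
case: (boolP (g %| N)%N) => gN.
  have e0N : (N %/ g %| N)%N by apply: dvdn_div.
  have e00 : (0 < N %/ g)%N by apply: dvdn_gt0 e0N.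
  rewrite -[X in weight _ _ X](divn_quotient _ _ N0 gN) Phi_weight // mulr_suml.
  rewrite big_seq_cond [RHS]big_seq_cond; apply: eq_big => [e|e].
    case eN: (e \in divisors N) => //=; rewrite -dvdn_divisors // in eN.
    rewrite dvdn_quotientC // /g dvdn_gcd.
    by rewrite (dvdn_trans (dvdn_div eN) N_dvd) andbT.
  rewrite -dvdn_divisors // => /andP[eN /dvdnP[k ek]].
  rewrite ek mulnK // -mulrA; congr (_ * _); rewrite -chi4M; congr chi4.
  have k0 : (0 < k)%N by move: (dvdn_gt0 N0 eN); rewrite ek muln_gt0 => /andP[].
  have kg : (k %| g)%N.
    by rewrite -(dvdn_pmul2r e00) -ek mulnC divnK.
  have -> : (N %/ (k * (N %/ g)) = g %/ k)%N.
    by rewrite mulnC divnMA divn_quotient.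
  by rewrite muln_divA ?dvdn_gcdl // mulnC divnA.
rewrite /weight ifF ?mul0r; last first.
  by apply: contraNF gN => /D_div; rewrite NE mulKn.
rewrite big_seq_cond big1 // => e; rewrite -dvdn_divisors // => /andP[eN dc].
case o: (odd (c %/ (N %/ e))); last by rewrite chi4_even ?o ?mulr0.
case/negP: gN; have := gcdn_quarter_dvd _ _ _ dc (dvdn_div eN) o.
by rewrite -NE.
Qed.

(** For d = N/e, the multiples of d in Z/n are dk with k < 4e, and the inner
    sum over k is that of [sum_chi4] at z = zeta^(jd).  Here z^4 = 1 exactly
    when e divides j, and then z = i^(j/e). *)
Lemma connection_sign_fourier (j : 'I_p.+2) :
  \sum_u (connection_sign p D sigma u)%:~R * zchar R p j u =
  'i * ((2 * half_eigenvalue N Phi j)%:~R : R)%:C.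
Proof.
have N0 := N_gt0.
pose G c := \sum_(e <- divisors N | (N %/ e %| c)%N)
  (Phi e)%:~R * ((chi4 (c %/ (N %/ e)))%:~R * zeta R p.+2 ^+ (j * c)) : R[i].
transitivity (\sum_(0 <= c < p.+2) G c).
  rewrite big_mkord; apply: eq_bigr => u _; rewrite connection_sign_expand rmorph_sum.
  rewrite mulr_suml; apply: eq_bigr => e _.
  by rewrite rmorphM mulrA.
rewrite {}/G; move: (nat_of_ord j) => {}j.
under eq_bigr do rewrite big_mkcond.
rewrite exchange_big /=.
have intC (x : int) : (x%:~R : R)%:C = x%:~R :> R[i].
  by apply: (rmorph_int (real_complex R)).
rewrite intC rmorphM /= rmorph_nat.
rewrite /half_eigenvalue rmorph_sum [in RHS]big_mkcond !mulr_sumr.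
rewrite big_seq [RHS]big_seq; apply: eq_bigr => e; rewrite -dvdn_divisors // => eN.
rewrite -big_mkcond -mulr_sumr.
have nE : p.+2 = ((N %/ e) * (4 * e))%N by rewrite mulnCA divnK.
have d0 : (0 < N %/ e)%N := dvdn_gt0 N0 (dvdn_div eN).
rewrite {1}nE sum_multiples //.
have z1 : (zeta R p.+2 ^+ (j * (N %/ e))) ^+ (4 * e) = 1.
  by rewrite -exprM -mulnA -nE mulnC exprM zeta_n // expr1n.
under eq_bigr do rewrite mulKn // mulnA exprM.
rewrite sum_chi4 // -exprM zeta_eq1 //.
have -> : (p.+2 %| j * (N %/ e) * 4)%N = (e %| j)%N.
  rewrite NE [(4 * N)%N]mulnC dvdn_pmul2r // -{1}(divnK eN) mulnC.
  by rewrite dvdn_pmul2r.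
case: ifP => [ej|_]; last by rewrite !mulr0.
have -> : zeta R p.+2 ^+ (j * (N %/ e)) = 'i%C ^+ (j %/ e).
  rewrite -(zeta_quarter R _ _ _ NE) // -exprM; congr (_ ^+ _).
  by rewrite -{1}(divnK ej) -mulnA [(e * _)%N]mulnC divnK // mulnC.
rewrite -exprM mulnC chi4_expi !rmorphM /=; ring.
Qed.
End Eigen.

(** * From transfer to 2-adic valuations and back *)

Lemma int_pow2_decomp (x : int) : x != 0 ->
  exists k c, x = 2 ^+ k * (2 * c + 1).
Proof.
move=> x0; have ax : (0 < `|x|)%N by rewrite absz_gt0.
have [m cm mE] := pfactor_coprime (isT : prime 2) ax.
have mh : (m = 1 + 2 * m./2)%N.
  by rewrite mul2n -{1}(odd_double_half m) -coprime2n cm.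
move: (logn 2 `|x|) mE => l mE; exists l.
have lE : (2 ^ l)%:Z = 2 ^+ l by rewrite -natz natrX.
case: (ltrP x 0) => sx.
  exists (- (m./2)%:Z - 1); rewrite [LHS]intEsign sx mE expr1 PoszM lE.
  by rewrite mulN1r -mulNr mulrC; congr (_ * _); move: mh; lia.
exists (m./2)%:Z; rewrite [LHS]intEsign ltNge sx mul1r mE PoszM lE mulrC.
by congr (_ * _); move: mh; lia.
Qed.

Section CisInt.
Variables (R : realType) (s : R).

Lemma cis_mul_int (x m : int) :
  cis R (s * (x * m)%:~R) = cis R (s * x%:~R) ^ m.
Proof. by rewrite -cisMz intrM mulrA mulrzr. Qed.

Lemma cis_even_multiple (x c : int) :
  cis R (s * x%:~R) = -1 -> cis R (s * (x * (2 * c))%:~R) = 1.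
Proof.
move=> E; rewrite cis_mul_int E -exprz_exp.
by rewrite -[(-1) ^ 2]/((-1) ^+ 2) sqrrN expr1n exp1rz.
Qed.

Lemma cis_odd_multiple (x c : int) :
  cis R (s * x%:~R) = -1 -> cis R (s * (x * (2 * c + 1))%:~R) = -1.
Proof.
move=> E; rewrite mulrDr mulr1 intrD mulrDr cisD E cis_even_multiple //.
by rewrite mul1r.
Qed.

(** If l > k, then an odd multiple of y is an even multiple of x, where the
    exponential would be both -1 and 1. *)
Lemma cisN1_valuation (x y c d : int) k l :
  cis R (s * x%:~R) = -1 -> cis R (s * y%:~R) = -1 ->
  x = 2 ^+ k * (2 * c + 1) -> y = 2 ^+ l * (2 * d + 1) -> (l <= k)%N.
Proof.
move=> Ex Ey xE yE; rewrite leqNgt; apply/negP => kl.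
have : y * (2 * c + 1) = x * (2 * (2 ^+ (l - k).-1 * (2 * d + 1))).
  rewrite xE yE -{1}(subnK (ltnW kl)) exprD -{1}[(l - k)%N]prednK ?subn_gt0 //.
  by rewrite exprS; ring.
move=> E; have := cis_odd_multiple y c Ey.
rewrite E cis_even_multiple // => /eqP.
by rewrite -subr_eq0 opprK -(natrD _ 1 1) pnatr_eq0.
Qed.
End CisInt.

Lemma odd_logn2 m a : (0 < m)%N -> logn 2 m = a ->
  exists2 q, odd q & m = (2 ^ a * q)%N.
Proof.
move=> m0 <-; have [q cq qE] := pfactor_coprime (isT : prime 2) m0.
by exists q; [rewrite -coprime2n | rewrite mulnC].
Qed.

Section Main.
Variables (R : realType) (p : nat) (D : {fset nat}) (sigma : nat -> int).
Hypothesis n4 : (4 %| p.+2)%N.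
Hypothesis D_div : forall d, d \in D -> (d %| p.+2 %/ 4)%N.
Hypothesis sigma_pm1 : forall d, d \in D -> sigma d = 1 \/ sigma d = -1.
Variables (N : nat) (Phi : nat -> int).
Hypothesis NE : p.+2 = (4 * N)%N.
Notation W := (fun e => weight D sigma (N %/ e)).
Hypothesis Phi_weight : forall e, (e %| N)%N ->
  W e = \sum_(f <- divisors N | (e %| f)%N) Phi f * chi4 (f %/ e).

Let N0 : (0 < N)%N. Proof. exact: N_gt0 NE. Qed.

Definition IOCG_eigenvalue (k : nat) : R := (2 * half_eigenvalue N Phi k)%:~R.

Lemma IOCG_pst_iff (u v : 'I_p.+2) :
  perfect_state_transfer R (IOCG p.+2 D sigma) u v <->
  exists t, forall k : 'I_p.+2,
    cis R (t * IOCG_eigenvalue k) = zchar R p k (v - u).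
Proof.
apply: (@circulant_pst_iff R p _ (connection_sign p D sigma)
  (fun k => IOCG_eigenvalue k)).
- by move=> x y; apply: hermitian_adj_IOCG.
- by move=> x; apply: connection_signN.
- by move=> j; apply: connection_sign_fourier.
rewrite /IOCG_eigenvalue /half_eigenvalue big1 ?mulr0 // => e _.
by rewrite div0n -[chi4 0]/(0 : int) mulr0.
Qed.

(** Transfer from 0 to N fixes t; conversely the transfer from b + s1 N to
    b + s2 N happens at time (s2 - s1) t, and s2 - s1 is replaced by
    s2 + 3 s1 because 4N = 0 in Z/n. *)
Lemma IOCG_mst_iff :
  (forall b : 'Z_p.+2,
     multiple_state_transfer R (IOCG p.+2 D sigma)
       [set b; b + (p.+2 %/ 4)%:R; b + (p.+2 %/ 2)%:R;
            b + (3 * (p.+2 %/ 4))%:R]%SET) <->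
  exists t, forall k, (k < p.+2)%N -> cis R (t * IOCG_eigenvalue k) = 'i%C ^+ k.
Proof.
have quarter : (p.+2 %/ 4 = N)%N by rewrite NE mulKn.
have half : (p.+2 %/ 2 = 2 * N)%N by rewrite NE -[4%N]/(2 * 2)%N -mulnA mulKn.
rewrite quarter half.
have vN s : nat_of_ord (((s * N)%N)%:R : 'Z_p.+2) = (s * N %% p.+2)%N.
  exact: (@val_Zp_nat p.+2).
have zE (k : 'I_p.+2) s : zchar R p k ((s * N)%N%:R : 'Z_p.+2) = 'i%C ^+ k ^+ s.
  rewrite /zchar vN -(zeta_quarter R _ _ _ NE) // -!exprM.
  rewrite -zeta_mod // modnMmr zeta_mod //.
  by rewrite mulnA [(_ * N)%N]mulnC.
split=> [H|[t Ht] b].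
  have := H 0 0 (0 + N%:R); rewrite !inE !eqxx !orbT /= => /(_ isT isT).
  have v1 := vN 1%N; rewrite mul1n modn_small in v1; last by rewrite NE; lia.
  have ne : 0 != 0 + N%:R :> 'Z_p.+2.
    by rewrite add0r -val_eqE /= [X in _ != X]v1 neq_ltn N0.
  move=> /(_ ne)/IOCG_pst_iff[t Ht]; exists t => k kn.
  have := Ht (Ordinal kn); rewrite /= => ->.
  by rewrite add0r subr0; have := zE (Ordinal kn) 1%N; rewrite mul1n expr1.
have inS x : x \in [set b; b + N%:R; b + (2 * N)%:R; b + (3 * N)%:R]%SET ->
    exists s, x = b + (s * N)%N%:R.
  rewrite !inE -!orbA => /or4P[] /eqP ->.
  - by exists 0%N; rewrite mul0n addr0.
  - by exists 1%N; rewrite mul1n.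
  - by exists 2%N.
  - by exists 3%N.
move=> u v /inS[s1 ->] /inS[s2 ->] _; apply/IOCG_pst_iff.
have -> : b + (s2 * N)%:R - (b + (s1 * N)%:R) = ((s2 + 3 * s1) * N)%:R :> 'Z_p.+2.
  apply/eqP; rewrite opprD addrACA subrr add0r subr_eq -natrD.
  have -> : ((s2 + 3 * s1) * N + s1 * N = s2 * N + s1 * p.+2)%N.
    by move: (NE); lia.
  by rewrite natrD [X in _ + X]natrM pchar_Zp // mulr0 addr0.
(* multiplying the time by an integer raises i^k to that power *)
exists (t * (s2 + 3 * s1)%:R) => k; rewrite zE.
by rewrite mulrAC mulr_natr cisMn Ht.
Qed.

(** For d in D and e = N/d, the 2-adic valuation of n/d = 4e is a + 2 exactly
    when e is 2^a times an odd number. *)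
Lemma D_val_single a : (2 ^ a %| N)%N ->
  D_val p.+2 D (a + 2) = [fset (N %/ 2 ^ a)%N]%fset <->
  W (2 ^ a)%N != 0 /\
  forall q, odd q -> (1 < q)%N -> (2 ^ a * q %| N)%N -> W (2 ^ a * q)%N = 0.
Proof.
move=> aN; have p0 : (0 < 2 ^ a)%N by rewrite expn_gt0.
have weight_neq0 d : (weight D sigma d != 0) = (d \in D).
  rewrite /weight; case: ifP => [/sigma_pm1[]->|] //; exact: eqxx.
have in_Dval d : (d \in D_val p.+2 D (a + 2)) = (d \in D) && (logn 2 (N %/ d) == a).
  rewrite !inE /=; case dD: (d \in D) => //=.
  have dN : (d %| N)%N by have := D_div _ dD; rewrite NE mulKn.
  rewrite NE -muln_divA // lognM ?(dvdn_gt0 N0 (dvdn_div dN)) //.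
  by rewrite addnC eqn_add2r.
have logq q : odd q -> logn 2 (2 ^ a * q) = a.
  move=> oq; rewrite lognM ?p0 //; last by case: q oq.
  by rewrite pfactorK // lognE dvdn2 oq /= andbF addn0.
split=> [DE|[W1 W0]].
  split.
    by rewrite weight_neq0; have := in_Dval (N %/ 2 ^ a)%N;
       rewrite DE inE eqxx => /esym/andP[].
  move=> q oq q1 qN; apply/eqP/negPn; rewrite weight_neq0; apply/negP => qD.
  have := in_Dval (N %/ (2 ^ a * q))%N.
  rewrite qD divn_quotient // logq // eqxx DE inE => /eqP E.
  have := divn_quotient _ _ N0 qN; rewrite E divn_quotient // => /eqP.
  rewrite -{1}[(2 ^ a)%N]muln1 eqn_pmul2l // => /eqP q1'.
  by rewrite -q1' in q1.
apply/fsetP => d; rewrite in_Dval inE; apply/andP/eqP => [[dD /eqP dl]|->].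
  have dN : (d %| N)%N by have := D_div _ dD; rewrite NE mulKn.
  have [q oq qE] := odd_logn2 _ _ (dvdn_gt0 N0 (dvdn_div dN)) dl.
  have : ~~ (1 < q)%N.
    apply/negP => q1; have := W0 q oq q1; rewrite -qE divn_quotient // dvdn_div //.
    by move=> /(_ isT)/eqP; apply/negP; rewrite weight_neq0.
  case: q oq qE => [|[|]] // _; rewrite muln1 => <- _.
  by rewrite divn_quotient.
rewrite -weight_neq0 W1 divn_quotient //; split=> //.
by have := logq 1%N isT; rewrite muln1 => ->.
Qed.

Lemma weight_pm1 e : W e != 0 -> W e = 1 \/ W e = -1.
Proof.
rewrite /= /weight; case: ifP => [/sigma_pm1 //|]; by rewrite eqxx.
Qed.

Lemma weight_even e : (2 %| W e)%Z -> W e = 0.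
Proof.
by rewrite /= /weight; case: ifP => // /sigma_pm1[] ->.
Qed.

(** Both cases reduce to one real s with exp(i s x) = -1 at the half
    eigenvalues x of index 2^a q: for a = 0 square the equation at q, for
    a = 1 take it at 2q, since i^(2q) = -1. *)
Lemma transfer_necessary t a :
  (forall k, (k < p.+2)%N -> cis R (t * IOCG_eigenvalue k) = 'i%C ^+ k) ->
  (a <= 1)%N ->
  [/\ (2 ^ a %| N)%N, W (2 ^ a)%N != 0 &
  forall q, odd q -> (1 < q)%N -> (2 ^ a * q %| N)%N -> W (2 ^ a * q)%N = 0].
Proof.
move=> Ht a1; have p0 : (0 < 2 ^ a)%N by rewrite expn_gt0.
have [s Hs] : exists s, forall q, odd q -> (2 ^ a * q < p.+2)%N ->
    cis R (s * (half_eigenvalue N Phi (2 ^ a * q))%:~R) = -1.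
  have iN1 q : odd q -> ('i%C ^+ q) ^+ 2 = -1 :> R[i].
    by move=> oq; rewrite exprAC sqr_i -signr_odd oq expr1.
  case: a a1 {p0} => [|[|//]] _.
    exists (4 * t) => q oq; rewrite mul1n => /Ht Hq.
    rewrite -(iN1 q oq) -Hq -cisMn; congr cis; rewrite /IOCG_eigenvalue intrM; ring.
  exists (2 * t) => q oq => /Ht Hq.
  rewrite -(iN1 q oq) -exprM [(q * 2)%N]mulnC -Hq; congr cis.
  rewrite /IOCG_eigenvalue intrM; ring.
have N_lt : (N < p.+2)%N by rewrite NE ltn_Pmull.
have base_lt : (2 ^ a < p.+2)%N.
  rewrite NE; apply: (@leq_trans 4); last by rewrite leq_pmulr.
  by case: a a1 {p0 Hs} => [|[|]].
have H1 := Hs 1%N isT; rewrite muln1 in H1; have {}H1 := H1 base_lt.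
have x0 : half_eigenvalue N Phi (2 ^ a) != 0.
  apply/eqP => E; move: H1; rewrite E mulr0 cis0 => /eqP.
  by rewrite -subr_eq0 opprK -(natrD _ 1 1) pnatr_eq0.
have aN : (2 ^ a %| N)%N.
  apply: contraNT x0 => aN; have := half_eigenvalue_pow2 N Phi a 1 isT.
  rewrite muln1 => ->; rewrite big_seq_cond big1 // => e.
  rewrite -dvdn_divisors // => /andP[eN /and3P[_ _ ae]].
  by rewrite (dvdn_trans ae eN) in aN.
have [k [c xE]] := int_pow2_decomp _ x0.
have [|W1 W0] := @weight_single N W Phi N0 Phi_weight weight_even a k aN; last by split.
move=> q oq qN.
have Hq : cis R (s * (half_eigenvalue N Phi (2 ^ a * q))%:~R) = -1.
  by apply: Hs => //; apply: leq_ltn_trans N_lt; apply: dvdn_leq.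
have y0 : half_eigenvalue N Phi (2 ^ a * q) != 0.
  apply/eqP => E; move: Hq; rewrite E mulr0 cis0 => /eqP.
  by rewrite -subr_eq0 opprK -(natrD _ 1 1) pnatr_eq0.
have [l [d yE]] := int_pow2_decomp _ y0.
have kl : k = l.
  apply/eqP; rewrite eqn_leq (cisN1_valuation _ _ _ _ _ _ _ _ Hq H1 yE xE).
  by rewrite (cisN1_valuation _ _ _ _ _ _ _ _ H1 Hq xE yE).
apply/dvdzP; exists d; rewrite yE kl exprS; ring.
Qed.

(** At time W(1) pi/4 the exponential at index k is i^(W(1) x), x being the
    half eigenvalue; now x is W(1) chi4(k), twice a sign, or a multiple of 4
    for k odd, twice odd, or divisible by 4. *)
Lemma transfer_sufficient :
  (2 %| N)%N ->
  (W 1 != 0 /\ forall q, odd q -> (1 < q)%N -> (q %| N)%N -> W q = 0) ->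
  (W 2 != 0 /\ forall q, odd q -> (1 < q)%N -> (2 * q %| N)%N -> W (2 * q)%N = 0) ->
  exists t, forall k, (k < p.+2)%N -> cis R (t * IOCG_eigenvalue k) = 'i%C ^+ k.
Proof.
move=> N2 [W1 W1q] [W2 W2q].
have half1 q : odd q -> half_eigenvalue N Phi q = W 1 * chi4 q.
  move=> oq; have := @half_eigenvalue_single N W Phi N0 Phi_weight 0 q (dvd1n _) oq.
  by rewrite mul1n mulr1; apply => k ok k1; rewrite mul1n; apply: W1q.
have half2 q : odd q -> half_eigenvalue N Phi (2 * q) = W 2 * 2 * chi4 q.
  move=> oq; have := @half_eigenvalue_single N W Phi N0 Phi_weight 1 q N2 oq.
  by apply => k ok k1; apply: W2q.
have i4 : 'i%C ^+ 4 = 1 :> R[i] by rewrite (exprM _ 2 2) sqr_i sqrrN expr1n.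
have i0 : 'i%C != 0 :> R[i] by rewrite complexiE neq0Ci.
have ik k : 'i%C ^+ k = 'i%C ^+ (k %% 4) :> R[i] by rewrite expr_mod.
have pm1 (e : int) : e = 1 \/ e = -1 -> (-1 : R[i]) ^ e = -1.
  by case=> ->; rewrite ?expr1z // exprN1 invrN1.
pose s : R := (W 1)%:~R * (pi / 4).
have sE x : cis R (s * (2 * x)%:~R) = 'i%C ^ (W 1 * x).
  rewrite -cis_pihalf -cisMz; congr cis; rewrite /s -[RHS]mulrzr !intrM; by field.
exists s => k _; rewrite /IOCG_eigenvalue sE.
have W11 : W 1 * W 1 = 1 by case: (weight_pm1 _ W1) => ->.
case ok: (odd k).
  rewrite half1 // mulrA W11 mul1r ik.
  case: (chi4_odd _ ok) => /eqP cE.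
    by move: (cE); rewrite chi4_eq1 (eqP cE) => /eqP ->.
  move: (cE); rewrite chi4_eqN1 (eqP cE) => /eqP ->.
  by rewrite -[(3 %% 4)%N]/3%N exprN1; apply: (mulfI i0); rewrite -exprS i4 divff.
have kE : k = (2 * k./2)%N by rewrite -{1}(odd_double_half k) ok mul2n.
rewrite kE; case oh: (odd k./2).
  rewrite half2 // exprM sqr_i -signr_odd oh expr1.
  have -> : W 1 * (W 2 * 2 * chi4 k./2) = 2 * (W 1 * (W 2 * chi4 k./2)) by ring.
  rewrite -exprz_exp -[_ ^ 2]/('i%C ^+ 2) sqr_i pm1 //.
  by case: (weight_pm1 _ W1) => ->; case: (weight_pm1 _ W2) => ->;
    case: (chi4_odd _ oh) => ->; [left|right|right|left|right|left|left|right].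
have k4 : (4 %| 2 * k./2)%N by rewrite (@dvdn_pmul2l 2 2) // dvdn2 oh.
have /dvdzP[c ->] := half_eigenvalue_dvd4 N Phi _ k4.
rewrite mulrA mulrC -exprz_exp -[_ ^ 4]/('i%C ^+ 4) i4 exp1rz.
by case/dvdnP: k4 => m ->; rewrite mulnC exprM i4 expr1n.
Qed.
End Main.

Theorem theorem1p3 (R : realType) (n : nat) (D : {fset nat})
    (sigma : nat -> int)
    (n_gt0 : (0 < n)%N) (n_mod4 : (4 %| n)%N)
    (D_neq0 : D != fset0)
    (D_div : forall d : nat, d \in D -> (d %| n %/ 4)%N)
    (sigma_pm1 : forall d : nat, d \in D -> sigma d = 1 \/ sigma d = -1) :
  (forall b : 'Z_n,
     multiple_state_transfer R (IOCG n D sigma)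
       [set b; b + (n %/ 4)%:R; b + (n %/ 2)%:R; b + (3 * (n %/ 4))%:R]%SET)
  <->
  [/\ (8 %| n)%N,
      D_val n D 2 = [fset (n %/ 4)%N]%fset
    & D_val n D 3 = [fset (n %/ 8)%N]%fset].
Proof.
case: n n_gt0 n_mod4 D_div => [//|[//|p]] _ n4 D_div.
set N := (p.+2 %/ 4)%N; have NE : p.+2 = (4 * N)%N by rewrite mulnC divnK.
have N0 : (0 < N)%N := N_gt0 _ _ NE.
have [Phi PhiE] := chi4_inversion N (fun e => weight D sigma (N %/ e)) N0.
have E8 : (p.+2 %/ 8 = N %/ 2)%N by rewrite NE -[8%N]/(4 * 2)%N divnMl.
have d8 : (8 %| p.+2)%N = (2 %| N)%N.
  by rewrite NE -[8%N]/(4 * 2)%N dvdn_pmul2l.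
have single a := D_val_single p D sigma D_div sigma_pm1 N NE a.
rewrite (IOCG_mst_iff R p D sigma n4 D_div sigma_pm1 N Phi NE PhiE) E8 d8.
split=> [[t Ht]|[N2 D2 D3]].
  have [] := transfer_necessary R p D sigma sigma_pm1 N Phi NE PhiE t 1 Ht isT.
  have [] := transfer_necessary R p D sigma sigma_pm1 N Phi NE PhiE t 0 Ht isT.
  move=> N1 W1 W1q N2 W2 W2q; split=> //.
    by have := (single 0 N1).2 (conj W1 W1q); rewrite divn1.
  exact: (single 1 N2).2 (conj W2 W2q).
apply: (transfer_sufficient R p D sigma sigma_pm1 N Phi NE PhiE N2).
  have [] := (single 0 (dvd1n _)).1; first by rewrite divn1.
  move=> W1 W1q; split=> // q oq q1 qN.
  by have := W1q q oq q1; rewrite mul1n; apply.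
exact: (single 1 N2).1.
Qed.
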